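(* Let $n\in\mathbb{N}=\{0,1,2,\ldots\}$ and let $r\in\{3,4,5,\ldots\}$. Then $2^{-n}\,\det\big[f^{(r)}_{i+j}\big]_{0\le i,j\le n}$ is an odd integer. Furthermore, $6^{-n}\,\det\big[f_{i+j}\big]_{0\le i,j\le n}$ is a positive odd integer.
   Context: For $m\in\mathbb{N}$, the Franel numbers are $f_m=\sum_{k=0}^m\binom{m}{k}^3$, and for an integer $r\ge 3$ the $r$-th order Franel numbers are $f^{(r)}_m=\sum_{k=0}^m\binom{m}{k}^r$. For a sequence $(a_m)_{m\ge0}$, $\det[a_{i+j}]_{0\le i,j\le n}$ denotes the determinant of the $(n+1)\times(n+1)$ Hankel matrix with $(i,j)$-entry $a_{i+j}$. *)

(* Defs.v *)
From mathcomp Require Import all_boot all_order all_algebra.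
Set Implicit Arguments. Unset Strict Implicit. Unset Printing Implicit Defensive.
Import Order.TTheory GRing.Theory Num.Theory.
Local Open Scope ring_scope.

Definition franel_r (r m : nat) : int := (\sum_(0 <= k < m.+1) ('C(m, k) ^ r)%N)%:Z.

Definition franel (m : nat) : int := franel_r 3 m.

Definition hankel_det (a : nat -> int) (n : nat) : int :=
  \det (\matrix_(i < n.+1, j < n.+1) a (i + j)%N).

(* Main.v *)
(* Modulo 2: f_0 = 1 and, by the symmetry of the binomial row and since r >= 2,
   f_(m+2) / 2 is congruent to the number of Dyck paths of length m. Dividing the rows below
   the first by 2 thus leaves, modulo 2, the Hankel matrix of these path numbers, which is
   T T^t for the unitriangular matrix T of ballot numbers.
   Modulo 3: f_m is congruent to 2^m, so the Hankel matrix has rank one.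
   Positivity: f_m is the constant term of P^m, where the Laurent polynomial
   P = (1 + x)(1 + y)(1 + 1/(xy)) is invariant under (x, y) -> (1/x, 1/y). Hence f_(i+j) is the
   scalar product of the coefficient vectors of P^i and P^j, which makes the Hankel matrix
   positive semidefinite; it is nonsingular because of the first part. *)
Require Import Defs.
From mathcomp Require Import all_boot all_order all_algebra.
From mathcomp Require Import zify ring.
Import Order.TTheory GRing.Theory Num.Theory.
Local Open Scope ring_scope.

(** * Row reduction, parity and symmetric sums *)

(** [A] factors as [L *m B] with [L] lower triangular and diagonal 1, [p], ..., [p]. *)
Lemma det_first_row_reduction (R : comNzRingType) (n : nat) (p : R) (c : 'I_n.+1 -> R)
    (A B : 'M[R]_n.+1) :
  (forall j, A ord0 j = B ord0 j) ->
  (forall i j, i != ord0 -> A i j = c i * A ord0 j + p * B i j) ->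
  \det A = p ^+ n * \det B.
Proof.
move=> A0 Ai.
pose L : 'M[R]_n.+1 := \matrix_(i, k) if k == ord0 then (if i == ord0 then 1 else c i)
  else p * (i == k)%:R.
have -> : A = L *m B.
  apply/matrixP => i j; rewrite !mxE (bigD1 ord0) //= !mxE eqxx.
  case: (eqVneq i ord0) => [->|i0].
    rewrite big1 ?addr0 ?mul1r // => k k0.
    by rewrite !mxE (negPf k0) eq_sym (negPf k0) mulr0 mul0r.
  rewrite (bigD1 i) //= !mxE (negPf i0) eqxx mulr1 big1 ?addr0.
    by rewrite Ai // A0.
  move=> k /andP[k0 ki].
  by rewrite !mxE (negPf k0) eq_sym (negPf ki) mulr0 mul0r.
rewrite det_mulmx det_trig; last first.
  apply/is_trig_mxP => i j ij; rewrite mxE.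
  case: eqP => [j0|_]; first by rewrite j0 in ij.
  case: eqP => [ij'|_]; first by rewrite ij' ltnn in ij.
  by rewrite mulr0.
rewrite big_ord_recl mxE eqxx mul1r; congr (_ * _).
under eq_bigr => i _ do rewrite mxE /= eqxx mulr1.
by rewrite prodr_const card_ord.
Qed.

Lemma natr_F2 (m : nat) : m%:R = (odd m)%:R :> 'F_2.
Proof. by rewrite -Zp_nat_mod // modn2. Qed.

Lemma odd_F2 (z : int) : odd `|z|%N = (z%:~R == 1 :> 'F_2).
Proof.
case: z => [m|m]; rewrite ?NegzE ?abszN ?absz_nat ?rmorphN /= -pmulrn natr_F2.
  by case: (odd m).
by rewrite /=; case: (odd m).
Qed.

Lemma sum_sym_odd (g : nat -> nat) (p : nat) :
  (forall k, k <= p.*2.+1 -> g (p.*2.+1 - k) = g k)%N ->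
  (\sum_(0 <= k < p.*2.+2) g k = (\sum_(0 <= k < p.+1) g k).*2)%N.
Proof.
move=> gS; rewrite (@big_cat_nat _ _ _ p.+1) //=; last by lia.
rewrite -[RHS]addnn; congr addn.
rewrite (big_addn 0) (_ : (p.*2.+2 - p.+1 = p.+1)%N); last by lia.
rewrite big_nat_rev /= !big_nat; apply: eq_bigr => k kp.
by rewrite -[RHS]gS; [congr g|]; lia.
Qed.

Lemma sum_sym_even (g : nat -> nat) (p : nat) :
  (forall k, k <= p.*2 -> g (p.*2 - k) = g k)%N ->
  (\sum_(0 <= k < p.*2.+1) g k = (\sum_(0 <= k < p) g k).*2 + g p)%N.
Proof.
move=> gS; rewrite (@big_cat_nat _ _ _ p) //=; last by lia.
rewrite [X in (_ + X = _)%N]big_ltn; last by lia.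
rewrite -[in RHS]addnn -addnA [(g p + _)%N]addnC; congr (_ + (_ + _))%N.
rewrite (big_addn 0) (_ : (p.*2.+1 - p.+1 = p)%N); last by lia.
rewrite big_nat_rev /= !big_nat; apply: eq_bigr => k kp.
by rewrite -[RHS]gS; [congr g|]; lia.
Qed.

Lemma sum_bin_nat (m : nat) : (\sum_(0 <= k < m.+1) 'C(m, k) = 2 ^ m)%N.
Proof.
by rewrite big_mkord (expnDn 1 1); apply: eq_bigr => i _; rewrite !exp1n !muln1.
Qed.

Lemma odd_sum_exp (g : nat -> nat) (r p : nat) : (0 < r)%N ->
  odd (\sum_(0 <= k < p) g k ^ r) = odd (\sum_(0 <= k < p) g k).
Proof.
move=> r0; elim: p => [|p IH]; first by rewrite !big_geq.
by rewrite !big_nat_recr //= !oddD IH oddX -[r == 0%N]negbK -lt0n r0.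
Qed.

Lemma bin_central_half (p : nat) : 'C(p.+1.*2, p.+1) = 'C(p.*2.+1, p).*2.
Proof.
rewrite doubleS binS -[RHS]addnn; congr addn.
by rewrite -bin_sub; [congr 'C(_, _)|]; lia.
Qed.

(** * Ballot numbers modulo 2 and their Hankel determinant *)

(* Number of nonnegative lattice paths with steps +1 and -1 from 0 to k of length i. *)
Fixpoint ballot (i k : nat) : nat :=
  match i, k with
  | 0, 0 => 1
  | 0, _.+1 => 0
  | i.+1, 0 => ballot i 1
  | i.+1, k.+1 => ballot i k + ballot i k.+2
  end.

Lemma ballot_gt (i k : nat) : (i < k)%N -> ballot i k = 0%N.
Proof.
elim: i k => [|i IH] [|k] //= ik.
by rewrite !IH //; lia.
Qed.

Lemma ballot_diag (i : nat) : ballot i i = 1%N.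
Proof. by elim: i => //= i ->; rewrite ballot_gt. Qed.

Lemma ballot_odd (i k : nat) : odd (i + k) -> ballot i k = 0%N.
Proof.
elim: i k => [|i IH] [|k] //=; first by move=> H; rewrite IH //; lia.
by move=> H; rewrite !IH //; lia.
Qed.

(** For i = k + 2l the ballot number is C(i,l) - C(i,l-1), which modulo 2 is C(i+1,l) by Pascal's
    rule. The induction also uses that central binomial coefficients are even, at the boundary k =
    0. *)
Lemma odd_ballot (k l : nat) :
  odd (ballot (k + l.*2) k) = odd 'C((k + l.*2).+1, l).
Proof.
move: {2}(k + l.*2)%N (erefl (k + l.*2)%N) => i; elim: i k l => [|i IH] k l E.
  have [-> ->] : k = 0%N /\ l = 0%N by lia.
  by [].
case: k E => [|k] E.
  case: l E => [|l] E; first by lia.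
  have Ei : (1 + l.*2 = i)%N by lia.
  rewrite E /= -{1}Ei IH // Ei binS oddD -[i.+1](_ : l.+1.*2 = _); last by lia.
  by rewrite bin_central_half odd_double.
rewrite E /= oddD -{1}[i](_ : k + l.*2 = i)%N; last by lia.
rewrite IH; last by lia.
case: l E => [|l] E; first by rewrite ballot_gt ?bin0 //; lia.
rewrite -[in X in _ (+) X](_ : k.+2 + l.*2 = i)%N; last by lia.
rewrite IH; last by lia.
by rewrite [in RHS]binS oddD; congr addb; congr (odd 'C(_, _)); lia.
Qed.

(* The transfer matrix of the path recurrence is symmetric, so a step can be moved
   from one factor to the other. *)
Lemma ballot_gram (K i j : nat) : (i < K)%N ->
  (\sum_(k < K) ballot i k * ballot j k = ballot (i + j) 0)%N.
Proof.
case: K => // K; elim: i j => [|i IH] j iK.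
  by rewrite big_ord_recl /= mul1n big1 ?addn0.
rewrite addSnnS -IH; last by lia.
have shift (a b : nat -> nat) : a K.+1 = 0%N ->
    (a 1 * b 0 + \sum_(k < K) a k.+2 * b k.+1 = \sum_(k < K) a k.+1 * b k)%N.
  move=> aK; transitivity (\sum_(k < K.+1) a k.+1 * b k)%N.
    by rewrite big_ord_recl.
  by rewrite big_ord_recr /= aK addn0.
have shift' (a b : nat -> nat) : a K = 0%N ->
    (a 0 * b 1 + \sum_(k < K) a k.+1 * b k.+2 = \sum_(k < K) a k * b k.+1)%N.
  move=> aK; transitivity (\sum_(k < K.+1) a k * b k.+1)%N.
    by rewrite big_ord_recl.
  by rewrite big_ord_recr /= aK addn0.
rewrite !big_ord_recl /=.
under eq_bigr => k _ do rewrite /bump /= add1n mulnDl.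
under [in RHS]eq_bigr => k _ do rewrite /bump /= add1n mulnDr.
rewrite !big_split /= addnCA (shift (ballot i) (ballot j)); last by apply: ballot_gt; lia.
rewrite [RHS]addnCA (shift' (ballot i) (ballot j)); last exact: ballot_gt.
by rewrite addnC.
Qed.

Lemma det_ballot_hankel (R : comNzRingType) (n : nat) :
  \det (\matrix_(i < n, j < n) ((ballot (i + j) 0)%:R : R)) = 1.
Proof.
pose T : 'M[R]_n := \matrix_(i, k) (ballot i k)%:R.
have -> : \matrix_(i < n, j < n) ((ballot (i + j) 0)%:R : R) = T *m T^T.
  apply/matrixP => i j; rewrite !mxE -(ballot_gram _ _ _ (ltn_ord i)) natr_sum.
  by apply: eq_bigr => k _; rewrite !mxE natrM.
rewrite det_mulmx det_tr det_trig.
  by rewrite big1 ?mulr1 // => i _; rewrite mxE ballot_diag.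
by apply/is_trig_mxP => i j ij; rewrite mxE ballot_gt.
Qed.

(** * The exact power of 2 *)

Lemma franel_half (r m : nat) : (1 < r)%N ->
  exists2 h : nat, franel_r r m.+2 = (2 * h)%:Z & odd h = odd (ballot m 0).
Proof.
move=> r1; rewrite /franel_r.
have [p [->|->]] : exists p, m = p.*2 \/ m = p.*2.+1.
  exists m./2; have := odd_double_half m; case: (odd m); [right|left]; lia.
- pose g k := 'C(p.+1.*2, k).
  have gS k : (k <= p.+1.*2 -> g (p.+1.*2 - k) = g k)%N by exact: bin_sub.
  have gSr k : (k <= p.+1.*2 -> g (p.+1.*2 - k) ^ r = g k ^ r)%N by move/gS->.
  have := sum_sym_even g p.+1 gS; rewrite sum_bin_nat doubleS expnS => E1.
  rewrite -doubleS (sum_sym_even (fun k => g k ^ r)%N p.+1 gSr).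
  move: E1; rewrite [g p.+1]bin_central_half; set c := 'C(_, _) => E1.
  (* The central entry is [2 * c]; half its [r]-th power is even because [r] exceeds 1. *)
  exists (\sum_(0 <= k < p.+1) g k ^ r + 2 ^ r.-1 * c ^ r)%N.
    congr Posz; rewrite -!mul2n expnMn -{2}(ltn_predK r1) expnS; ring.
  rewrite oddD odd_sum_exp ?(ltnW r1) // oddM oddX.
  have -> : (r.-1 == 0)%N = false by lia.
  rewrite /= addbF -[p.*2]add0n odd_ballot add0n -/c.
  have : (\sum_(0 <= k < p.+1) g k + c = 2 ^ p.*2.+1)%N by lia.
  by move/(congr1 odd); rewrite oddD oddX /=; case: odd; case: odd.
- pose g k := 'C(p.+1.*2.+1, k).
  have gS k : (k <= p.+1.*2.+1 -> g (p.+1.*2.+1 - k) = g k)%N by exact: bin_sub.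
  have gSr k : (k <= p.+1.*2.+1 -> g (p.+1.*2.+1 - k) ^ r = g k ^ r)%N by move/gS->.
  have := sum_sym_odd g p.+1 gS; rewrite sum_bin_nat expnS => E1.
  rewrite -!doubleS (sum_sym_odd (fun k => g k ^ r)%N p.+1 gSr).
  exists (\sum_(0 <= k < p.+2) g k ^ r)%N; first by rewrite mul2n.
  rewrite odd_sum_exp ?(ltnW r1) // ballot_odd; last by lia.
  have -> : (\sum_(0 <= k < p.+2) g k = 2 ^ p.+1.*2)%N by lia.
  by rewrite oddX.
Qed.

Lemma franel_r1 (r : nat) : franel_r r 1 = 2.
Proof. by rewrite /franel_r !big_nat_recr ?big_geq //= !bin1 bin0 exp1n. Qed.

Lemma hankel_det_franel_r_odd (r n : nat) : (1 < r)%N ->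
  exists2 k : int, odd `|k|%N & hankel_det (franel_r r) n = 2 ^+ n * k.
Proof.
move=> r1; pose f := franel_r r; pose h m := (f m %/ 2)%Z.
have fh m : (0 < m)%N -> f m = 2 * h m.
  case: m => [//|[|m]] _; first by rewrite /h /f franel_r1.
  have [g fg _] := franel_half r m r1.
  by rewrite /h /f fg PoszM mulKz.
have hF2 m : (h m.+2)%:~R = (ballot m 0)%:R :> 'F_2.
  have [g fg og] := franel_half r m r1.
  rewrite /h /f fg PoszM mulKz // -pmulrn.
  by rewrite (natr_F2 g) og -natr_F2.
pose B : 'M[int]_n.+1 := \matrix_(i, j) if i == ord0 then f j else h (i + j)%N.
exists (\det B); last first.
  rewrite /hankel_det (det_first_row_reduction _ _ 2 (fun _ => 0) _ B) //.
    by move=> j; rewrite !mxE.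
  move=> i j i0; rewrite !mxE (negPf i0) mul0r add0r -/f fh // addn_gt0.
  by rewrite lt0n i0.
(* Modulo 2 the first row of [B] is (1, 0, ..., 0), so only the corner cofactor survives; its
   entries [h (i + j).+2] reduce to ballot numbers. *)
rewrite odd_F2 -det_map_mx (expand_det_row _ ord0) (bigD1 ord0) //=.
rewrite big1 ?addr0; last first.
  move=> j j0; rewrite !mxE eqxx fh ?lt0n //.
  by rewrite intrM (_ : 2%:~R = 0 :> 'F_2) ?mul0r //; apply/val_inj.
rewrite !mxE eqxx /f /franel_r big_nat1 exp1n mul1r /cofactor /= expr0 mul1r.
apply/eqP; rewrite -[RHS](det_ballot_hankel 'F_2 n); congr (\det _).
by apply/matrixP => i j; rewrite !mxE /= /bump /= !add1n addSn addnS hF2.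
Qed.

(** * Divisibility by powers of 3 *)

(** Fermat's congruence removes the cubes and leaves the binomial row sum. *)
Lemma franel_mod3 (m : nat) : (3 %| franel m - 2 ^+ m)%Z.
Proof.
have cube (x : nat) : (x ^ 3 = x %[mod 3])%N.
  rewrite -modnXm; have := ltn_pmod x (isT : 0 < 3)%N.
  by case: (x %% 3)%N => [|[|[|]]].
have -> : (2 ^+ m : int) = (2 ^ m)%N by rewrite -natrX natz.
rewrite -eqz_mod_dvd /franel /franel_r -sum_bin_nat !modz_nat eqz_nat.
elim: m.+1 => [|k IH]; first by rewrite !big_geq.
by rewrite !big_nat_recr //= -modnDm (eqP IH) cube modnDm.
Qed.

(** Subtracting [2 ^+ i] times row 0 from row [i] makes row [i] divisible by 3. *)
Lemma hankel_det_franel_dvd3 (n : nat) : (3 ^+ n %| hankel_det franel n)%Z.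
Proof.
pose B : 'M[int]_n.+1 := \matrix_(i, j) if i == ord0 then franel j
  else ((franel (i + j) - 2 ^+ i * franel j) %/ 3)%Z.
rewrite /hankel_det (det_first_row_reduction _ _ 3 (fun i => 2 ^+ i) _ B) ?dvdz_mulr //.
  by move=> j; rewrite !mxE.
move=> i j i0; rewrite !mxE (negPf i0).
have dvd3 : (3 %| franel (i + j) - 2 ^+ i * franel j)%Z.
  have -> : franel (i + j) - 2 ^+ i * franel j =
    (franel (i + j) - 2 ^+ (i + j)) - 2 ^+ i * (franel j - 2 ^+ j).
    by rewrite exprD mulrBr opprB addrA subrK.
  by rewrite rpredB ?dvdz_mull ?franel_mod3.
by rewrite [X in _ = _ + X]mulrC divzK // addrC subrK.
Qed.

(** * Palindromic polynomials and the Gram factorization *)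

(** [D] is a formal degree: zeros at both ends are allowed, so that multiplying by a power of the
    variable only moves the centre of symmetry D/2. *)
Definition palindromic (R : nzRingType) (D : nat) (p : {poly R}) :=
  (size p <= D.+1)%N /\ forall k, (k <= D)%N -> p`_(D - k) = p`_k.

(** The summation range does not depend on [k], so [palindromicM] can reverse it. *)
Lemma coefM_le (R : comNzRingType) (D k : nat) (p q : {poly R}) : (size p <= D.+1)%N ->
  (p * q)`_k = \sum_(i < D.+1) p`_i * (if (k < i)%N then 0 else q`_(k - i)).
Proof.
move=> sp; have {1}-> : p = \sum_(i < D.+1) p`_i *: 'X^i.
  rewrite -poly_def; apply/polyP => i; rewrite coef_poly; case: ltnP => // Di.
  by rewrite nth_default // (leq_trans sp).
rewrite mulr_suml coef_sum; apply: eq_bigr => i _.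
by rewrite -scalerAl coefZ coefXnM.
Qed.

Lemma palindromicM (R : comNzRingType) (D E : nat) (p q : {poly R}) :
  palindromic R D p -> palindromic R E q -> palindromic R (D + E) (p * q).
Proof.
move=> [sp pp] [sq pq]; split.
  by apply: leq_trans (size_polyMleq _ _) _; lia.
move=> k kDE; rewrite !(coefM_le _ D) // (reindex_inj rev_ord_inj) /=.
apply: eq_bigr => i _; have iD := ltn_ord i.
rewrite subSS pp //; congr (_ * _).
(* An index of [q] below 0 on one side is an index above [E] on the other; both terms vanish. *)
case: (ltnP k i) => ki.
  by case: ltnP => // _; rewrite nth_default //; apply: leq_trans sq _; lia.
case: ltnP => kE; first by rewrite nth_default //; apply: leq_trans sq _; lia.
by rewrite -[RHS]pq; [congr (q`_ _)|]; lia.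
Qed.

Lemma palindromicX (R : comNzRingType) (D m : nat) (p : {poly R}) :
  palindromic R D p -> palindromic R (D * m) (p ^+ m).
Proof.
move=> pp; elim: m => [|m IH].
  by rewrite muln0 expr0; split; [rewrite size_poly1 | case].
by rewrite exprS mulnS; apply: palindromicM.
Qed.

Lemma palindromicXn (R : comNzRingType) (e : nat) : palindromic R (e * 2) 'X^e.
Proof.
split=> [|k ke]; first by rewrite size_polyXn; lia.
by rewrite !coefXn; congr (_%:R); congr nat_of_bool; lia.
Qed.

Lemma palindromicXnD1 (R : comNzRingType) (e : nat) : palindromic R e ('X^e + 1).
Proof.
split=> [|k ke].
  by apply: leq_trans (size_polyD _ _) _; rewrite size_polyXn size_poly1 geq_max leqnn.
rewrite !coefD !coefXn !coef1 addrC.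
by congr (_%:R + _%:R); congr nat_of_bool; lia.
Qed.

(* The image under Y := X^L of the Laurent polynomial (1 + X)(1 + Y)(1 + 1/(XY)), whose
   m-th power has constant term [franel m], multiplied by X^(L+1). *)
Definition franel_poly (L : nat) : {poly int} :=
  ('X + 1) * ('X^L + 1) * ('X^(L.+1) + 1).

(** The terms of the three binomial expansions reach this degree only if s + L t = (L+1) u. Since s,
    t, u are at most [m] and [m < L], this forces s = t = u and leaves the sum of cubes. *)
Lemma coef_franel_poly (L m : nat) : (m < L)%N ->
  (franel_poly L ^+ m)`_(L.+1 * m) = franel m.
Proof.
move=> mL; rewrite /franel_poly !exprMn (exprD1n 'X) (exprD1n 'X^L) exprDn big_distrlr mulr_suml coef_sum.
rewrite /franel /franel_r big_mkord -natz natr_sum; apply: eq_bigr => s _.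
rewrite mulr_suml coef_sum.
have coefE (t u : 'I_m.+1) :
    ('X^s *+ 'C(m, s) * ('X^L ^+ t *+ 'C(m, t)) *
       ('X^(L.+1) ^+ (m - u) * 1 ^+ u *+ 'C(m, u)) : {poly int})`_(L.+1 * m) =
    if (t == s) && (u == s) then ('C(m, s) * ('C(m, t) * 'C(m, u)))%:R else 0.
  rewrite expr1n mulr1 -!exprM !mulrnAr !mulrnAl -!mulrnA -!exprD coefMn coefXn.
  suff -> : (L.+1 * m == s + L * t + L.+1 * (m - u))%N = (t == s) && (u == s).
    by case: ifP; rewrite ?mul0rn.
  have [sm tm um] := And3 (ltn_ord s) (ltn_ord t) (ltn_ord u).
  have -> : (L.+1 * m = L.+1 * u + L.+1 * (m - u))%N by rewrite -mulnDr subnKC.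
  rewrite eqn_add2r -!val_eqE /=.
  have [tu|ut|<-] := ltngtP t u.
  - have [d ->] : exists d, u = (t + d.+1)%N :> nat by exists (u - t.+1)%N; lia.
    by apply/eqP/andP => [|[]]; nia.
  - have [d ->] : exists d, t = (u + d.+1)%N :> nat by exists (t - u.+1)%N; lia.
    by apply/eqP/andP => [|[]]; nia.
  - by rewrite andbb; apply/eqP/eqP; nia.
under eq_bigr => t _ do rewrite mulr_sumr coef_sum.
rewrite (bigD1 s) //= (bigD1 s) //= coefE !eqxx !big1 ?addr0.
- by rewrite !expnS expn0 muln1.
- by move=> t ts; apply: big1 => u _; rewrite coefE (negPf ts).
- by move=> u us; rewrite coefE (negPf us) andbF.
Qed.

Lemma franel_gram (n : nat) : exists (K : nat) (V : 'M[int]_(n.+1, K)),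
  \matrix_(i < n.+1, j < n.+1) franel (i + j) = V *m V^T.
Proof.
(* This [L] exceeds every [i + j], as [coef_franel_poly] requires. *)
pose L := n.*2.+1; pose D := (L.+1 * n.*2)%N.
(* The shift gives all [p i] the same centre of symmetry D/2 = (L+1) n, so the coefficient of degree
   [D] in [p i * p j] is a scalar product. *)
pose p i : {poly int} := 'X^(L.+1 * (n - i)) * franel_poly L ^+ i.
have pp i : (i <= n)%N -> palindromic int D (p i).
  move=> ni; have -> : D = (L.+1 * (n - i) * 2 + (1 + L + L.+1) * i)%N.
    by rewrite -{1}(subnK ni) /D; nia.
  apply: palindromicM; first exact: palindromicXn.
  apply: palindromicX; rewrite /franel_poly.
  do 2![apply: palindromicM; last exact: palindromicXnD1].
  by have := palindromicXnD1 int 1; rewrite expr1.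
exists D.+1, (\matrix_(i, k) (p i)`_k); apply/matrixP => i j; rewrite !mxE.
have [ni nj] := conj (ltn_ord i) (ltn_ord j).
transitivity ((p i * p j)`_D).
  rewrite /p mulrACA -!exprD coefXnM -mulnDr.
  have -> : (D = L.+1 * (n - i + (n - j)) + L.+1 * (i + j))%N.
    by rewrite -mulnDr; congr muln; lia.
  by rewrite ltnNge leq_addr /= addKn coef_franel_poly //; rewrite /L; lia.
rewrite coefM; apply: eq_bigr => k _; rewrite !mxE; congr (_ * _).
by case: (pp j _) => // _ -> //; rewrite -ltnS.
Qed.

(** * Positivity *)

(** For [w] the [i]-th row of the adjugate of H, w H is det H times a unit vector, so the product
    equals w H w^T, the squared norm of w V. *)
Lemma gram_det_cofactor_ge0 (R : realDomainType) (n K : nat) (V : 'M[R]_(n, K)) (i : 'I_n) :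
  0 <= \det (V *m V^T) * cofactor (V *m V^T) i i.
Proof.
set H := V *m V^T; pose w := row i (\adj H).
have -> : \det H * cofactor H i i = ((w *m V) *m (w *m V)^T) 0 0.
  rewrite trmx_mul mulmxA -(mulmxA w) -/H.
  by rewrite -row_mul mul_adj_mx rowE mul_mx_scalar -scalemxAl -rowE !mxE.
by rewrite mxE sumr_ge0 // => k _; rewrite [_^T _ _]mxE -expr2 sqr_ge0.
Qed.

(** The last diagonal cofactor is the preceding Hankel determinant, so consecutive determinants have
    a nonnegative product; none is zero, by the parity result. *)
Lemma hankel_det_franel_gt0 (n : nat) : 0 < hankel_det franel n.
Proof.
have D0 m : hankel_det franel m != 0.
  have [k ok ->] := hankel_det_franel_r_odd 3 m isT.
  by rewrite mulf_neq0 ?expf_neq0 //; apply: contraTneq ok => ->.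
elim: n => [|n IH].
  by rewrite /hankel_det det_mx11 mxE /franel /franel_r big_nat1.
rewrite lt_def D0 /= -(pmulr_lge0 _ IH).
have [K [V HV]] := franel_gram n.+1.
have -> : hankel_det franel n = cofactor (V *m V^T) ord_max ord_max.
  rewrite /cofactor -signr_odd addnn odd_double expr0 mul1r -HV.
  by congr (\det _); apply/matrixP => i j; rewrite !mxE !lift_max.
by rewrite /hankel_det HV gram_det_cofactor_ge0.
Qed.

Theorem theorem1p1 (n r : nat) (hr : (3 <= r)%N) :
  (exists k : int, odd `|k|%N /\ hankel_det (franel_r r) n = 2 ^+ n * k) /\
  (exists k : int, 0 < k /\ odd `|k|%N /\ hankel_det franel n = 6 ^+ n * k).
Proof.
split.
  by have [k ok ->] := hankel_det_franel_r_odd r n (ltnW hr); exists k.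
have [k ok Dk] : exists2 k : int, odd `|k|%N & hankel_det franel n = 2 ^+ n * k.
  exact: hankel_det_franel_r_odd.
(* As 2^n and 3^n are coprime, 3^n divides the odd cofactor [k], and the quotient stays odd. *)
have := hankel_det_franel_dvd3 n; rewrite Dk Gauss_dvdzr; last first.
  by rewrite coprimezE !abszX coprimeXl ?coprimeXr.
case/dvdzP => q kq; exists q.
have Dq : hankel_det franel n = 6 ^+ n * q.
  by rewrite Dk kq (_ : 6 = 2 * 3) // exprMn; ring.
rewrite -Dk; split; last split=> //.
  by have := hankel_det_franel_gt0 n; rewrite Dq pmulr_rgt0 // exprn_gt0.
by move: ok; rewrite kq abszM oddM => /andP[].
Qed.
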